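(* For integers $n \geq k \geq 2$ and $i \geq 2$, $$f_{(n,k,2),i}(q) = q^{k+i^2-3i+6} \frac{(1-q^{n-k+1})(1-q^{k-1})(1-q^n)}{(1-q^{i-1})(1-q)(1-q^2)} \begin{bmatrix} n+1 \\ i-2 \end{bmatrix}_q \begin{bmatrix} k \\ i-2 \end{bmatrix}_q.$$
   Context: For a partition $\lambda\vdash N$, a standard Young tableau of shape $\lambda$ is a filling of the Ferrers diagram (row $r$ has $\lambda_r$ left-justified boxes, rows top to bottom) with $1,\dots,N$, increasing along rows and down columns. It has a descent at $m$ if $m+1$ lies in a strictly lower row than $m$; $\mathrm{des}$ is the number of descents and $\mathrm{maj}$ their sum. $f_{\lambda,i}(q)=\sum q^{\mathrm{maj}(\tau)}$ over standard Young tableaux $\tau$ of shape $\lambda$ with $\mathrm{des}(\tau)=i$. The $q$-binomial coefficient is $\begin{bmatrix} M \\ N \end{bmatrix}_q = \frac{(q)_M}{(q)_N(q)_{M-N}}$ with $(q)_m=(1-q)\cdots(1-q^m)$ when $0\le N\le M$ are integers, and $0$ otherwise. *)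

(* Defs.v *)
From HB Require Import structures.
From mathcomp Require Import all_boot all_order all_algebra all_fingroup.
Set Implicit Arguments. Unset Strict Implicit. Unset Printing Implicit Defensive.
Import Order.TTheory GRing.Theory Num.Theory.
Local Open Scope ring_scope.

(* A filling of the Ferrers diagram of lam (rows top to bottom, row r has
   nth 0 lam r boxes) with 1..N, N = sumn lam, is encoded by a permutation
   s of 'I_N: the box (r,c) (reading index flatten_index lam r c) receives
   the value (s (flatten_index lam r c)) + 1.  This is a bijection between
   such fillings and permutations. *)
Definition filling_vals (lam : seq nat) (s : 'S_(sumn lam)) : seq nat :=
  [seq (s j).+1 | j <- enum 'I_(sumn lam)].

Definition entry (lam : seq nat) (s : 'S_(sumn lam)) (r c : nat) : nat :=
  nth 0%N (filling_vals s) (flatten_index lam r c).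

Definition is_SYT (lam : seq nat) (s : 'S_(sumn lam)) : bool :=
  [forall r : 'I_(size lam), forall c : 'I_(sumn lam),
     ((c.+1 < nth 0%N lam r)%N ==> (entry s r c < entry s r c.+1)%N) &&
     (((r.+1 < size lam) && (c < nth 0%N lam r.+1))%N ==>
        (entry s r c < entry s r.+1 c)%N)].

Definition row_of (lam : seq nat) (s : 'S_(sumn lam)) (m : nat) : nat :=
  reshape_index lam (index m (filling_vals s)).

Definition descents (lam : seq nat) (s : 'S_(sumn lam)) : seq nat :=
  [seq m <- iota 1 (sumn lam).-1 | (row_of s m < row_of s m.+1)%N].

Definition des (lam : seq nat) (s : 'S_(sumn lam)) : nat := size (descents s).
Definition maj (lam : seq nat) (s : 'S_(sumn lam)) : nat := sumn (descents s).

Definition f_poly (lam : seq nat) (i : nat) : {poly int} :=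
  \sum_(s : 'S_(sumn lam) | is_SYT s && (des s == i)) 'X^(maj s).

Notation RF := {fraction {poly rat}}.
Definition toRF (p : {poly rat}) : RF := FracField.tofrac p.
Definition q : RF := toRF 'X.
Definition intRF (p : {poly int}) : RF := toRF (map_poly intr p).

Definition qpoch (m : nat) : RF := \prod_(1 <= j < m.+1) (1 - q ^+ j).

Definition qbinom (M N : nat) : RF :=
  if (N <= M)%N then qpoch M / (qpoch N * qpoch (M - N)) else 0.

(* Main.v *)
(* Reading off the row of each of 1, ..., N turns standard Young tableaux of shape
   lam into ballot words of content lam, and descents of tableaux into ascents of
   consecutive letters.  Let T(n,k,c) be the generating polynomial of the tableaux
   of shape (n,k,c), with z marking des and q marking maj.  Deleting the last letter
   of a word gives, with z_m = z q^m,
     T(n+1,k+1,c) = T(n,k+1,c) + T(n+1,k,c) - (1 - z_(n+k+c+1)) T(n,k,c) + S_c,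
   where S_0 = 0, S_1 = z_(n+k+2) T(n+1,k+1,0) and
     S_2 = z_(n+k+3) T(n+1,k+1,1) + (1 - z_(n+k+3)) z_(n+k+2) T(n+1,k+1,0).
   Comparing coefficients of z^i, the mixed difference in (n,k) of each coefficient
   is expressed by coefficients of lower degree, and a function is determined by its
   mixed difference and its values at k = 0 and k = n + 1.  The three families of
   coefficients have product formulas, namely, with [a,b] the q-binomial,
     c = 0:  q^(k+i^2-i) (1-q^(n-k+1)) / (1-q^i) [n,i-1] [k-1,i-1],
     c = 1:  q^(k+i^2-2i+2) (1-q^(n-k+1)) (1-q^(i-1)) / ((1-q) (1-q^i))
               [n+1,i-1] [k,i-1],
   and the asserted one for c = 2; each is verified through its mixed difference. *)
Require Import Defs.
From HB Require Import structures.
From mathcomp Require Import all_boot all_order all_algebra all_fingroup.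
From mathcomp Require Import zify ring.
Set Implicit Arguments. Unset Strict Implicit. Unset Printing Implicit Defensive.
Import GRing.Theory.

(** * Tableaux and ballot words *)

Definition content (d : nat) (w : seq nat) : seq nat :=
  mkseq (fun r => count_mem r w) d.

Definition ballot (d : nat) (w : seq nat) : bool :=
  all (fun p => sorted geq (content d (take p w))) (iota 0 (size w).+1).

Lemma ballotP d w :
  reflect (forall p r, p <= size w -> r.+1 < d ->
             count_mem r.+1 (take p w) <= count_mem r (take p w))
          (ballot d w).
Proof.
apply: (iffP allP) => [bal p r ple rd | bal p].
  have /bal : p \in iota 0 (size w).+1 by rewrite mem_iota; lia.
  move/(sortedP 0)/(_ r); rewrite size_mkseq => /(_ rd).
  by rewrite !nth_mkseq //; lia.
rewrite mem_iota => ple; apply/(sortedP 0) => r; rewrite size_mkseq => rd.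
by rewrite !nth_mkseq ?[r < d]ltnW //; apply: bal.
Qed.

Lemma count_take_card (N : nat) (w : seq nat) (x p : nat) : size w = N -> p <= N ->
  count_mem x (take p w) = #|[set m : 'I_N | (m < p) && (nth 0 w m == x)]|.
Proof.
move=> sw pN.
rewrite -sum1_card -sum1_count (big_nth 0) size_takel ?sw //.
rewrite (big_nat_widen _ _ N) // big_mkord; apply: eq_bigl => m; rewrite inE andbC.
by case: ltnP => //= mp; rewrite nth_take.
Qed.

(** The occurrence at position [m] itself is counted only in the longer prefix. Such counts serve as
    columns, which therefore grow along equal letters. *)
Lemma count_take_lt (w : seq nat) (m m' : nat) : m < m' -> m < size w ->
  count_mem (nth 0 w m) (take m w) < count_mem (nth 0 w m) (take m' w).
Proof.
move=> mm' mw; apply: (@leq_trans (count_mem (nth 0 w m) (take m.+1 w))).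
  by rewrite (take_nth 0) // -cats1 count_cat /= eqxx addn0 addn1.
by rewrite -(cat_take_drop m.+1 (take m' w)) take_takel // count_cat leq_addr.
Qed.

Section Tableaux.

Variable lam : seq nat.
Local Notation N := (sumn lam).
Local Notation row := (reshape_index lam).
Local Notation col := (reshape_offset lam).

Lemma eq_row_col (j j' : nat) : row j = row j' -> col j = col j' -> j = j'.
Proof. by move=> er ec; rewrite -(reshape_indexK lam j) er ec reshape_indexK. Qed.

Lemma card_row_prefix (r c : nat) : c <= nth 0 lam r ->
  #|[set j : 'I_N | (row j == r) && (col j < c)]| = c.
Proof.
move=> cr.
have lt_box (x : 'I_c) : x < nth 0 lam r := leq_trans (ltn_ord x) cr.
pose box (x : 'I_c) := Ordinal (flatten_indexP (lt_box x)).
have box_inj : injective box.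
  move=> x y [/(congr1 (reshape_offset lam))].
  by rewrite !flatten_indexKr // => exy; apply/val_inj.
rewrite -[RHS]card_ord -cardsT -(card_imset _ box_inj); apply: eq_card => j.
rewrite inE; apply/andP/imsetP => [[/eqP rj cj] | [x _ ->]].
  exists (Ordinal cj) => //; apply/val_inj/esym => /=.
  by rewrite -rj reshape_indexK.
by rewrite /= flatten_indexKl ?flatten_indexKr.
Qed.

Definition tableau_word (s : 'S_N) : seq nat := [seq row_of s m | m <- iota 1 N].

Lemma size_tableau_word s : size (tableau_word s) = N.
Proof. by rewrite size_map size_iota. Qed.

Lemma nth_filling_vals (s : 'S_N) (j : 'I_N) : nth 0 (filling_vals s) j = (s j).+1.
Proof. by rewrite (nth_map j) ?size_enum_ord // nth_ord_enum. Qed.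

Lemma index_filling_vals (s : 'S_N) (j : 'I_N) : index (s j).+1 (filling_vals s) = j.
Proof.
rewrite -nth_filling_vals index_uniq //; first by rewrite size_map size_enum_ord.
rewrite /filling_vals map_inj_uniq ?enum_uniq // => x y [] /val_inj; exact: perm_inj.
Qed.

Lemma nth_tableau_word (s : 'S_N) (m : 'I_N) :
  nth 0 (tableau_word s) m = row ((s^-1)%g m).
Proof.
rewrite (nth_map 0) ?size_iota // nth_iota // add1n /row_of.
by rewrite -{1}(permKV s m) index_filling_vals.
Qed.

Lemma entryE (s : 'S_N) (j : 'I_N) : entry s (row j) (col j) = (s j).+1.
Proof. by rewrite /entry reshape_indexK nth_filling_vals. Qed.

Lemma leq_nth_sumn r : nth 0 lam r <= N.
Proof.
elim: lam r => [|x l IH] [|r] //=; first exact: leq_addr.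
by apply: leq_trans (IH r) _; apply: leq_addl.
Qed.

Lemma SYT_row_lt (s : 'S_N) r c c' : is_SYT s -> r < size lam -> c < c' ->
  c' < nth 0 lam r -> entry s r c < entry s r c'.
Proof.
move=> /forallP sytP rs; elim: c' => // c' IH; rewrite ltnS leq_eqVlt => cc' lc'.
have step : entry s r c' < entry s r c'.+1.
  have c'N : c' < N by apply: leq_trans (leq_nth_sumn r); lia.
  move: (sytP (Ordinal rs)) => /forallP/(_ (Ordinal c'N)) /= /andP[/implyP + _].
  exact.
case/orP: cc' => [/eqP -> // | cc'].
by apply: ltn_trans step; apply: IH => //; lia.
Qed.

Lemma SYT_col_lt (s : 'S_N) r c : is_SYT s -> r.+1 < size lam ->
  c < nth 0 lam r.+1 -> entry s r c < entry s r.+1 c.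
Proof.
move=> /forallP sytP rs lc.
have cN : c < N by apply: leq_trans lc (leq_nth_sumn _).
move: (sytP (Ordinal (ltnW rs))) => /forallP/(_ (Ordinal cN)) /= /andP[_ /implyP].
by apply; rewrite rs.
Qed.

(** Position [m] of the word carries the row of the box [s^-1 m], so [s] maps the boxes on the right
    onto the positions counted on the left. *)
Lemma count_take_tableau_word (s : 'S_N) r p : p <= N ->
  count_mem r (take p (tableau_word s)) = #|[set j : 'I_N | (s j < p) && (row j == r)]|.
Proof.
move=> pN; rewrite (count_take_card _ (size_tableau_word s) pN).
rewrite -[RHS](card_imset _ (@perm_inj _ s)); apply: eq_card => m; rewrite inE.
rewrite nth_tableau_word; apply/idP/imsetP => [mp | [j + ->]].
  by exists ((s^-1)%g m); rewrite ?inE permKV.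
by rewrite inE permK.
Qed.

Lemma content_tableau_word (s : 'S_N) : content (size lam) (tableau_word s) = lam.
Proof.
apply: (@eq_from_nth _ 0); rewrite size_mkseq // => r rs.
rewrite nth_mkseq // -[tableau_word s](take_size) size_tableau_word.
rewrite count_take_tableau_word // -[RHS](card_row_prefix (leqnn _)).
apply: eq_card => j; rewrite !inE ltn_ord /=.
by case: eqP => //= <-; rewrite reshape_offsetP.
Qed.

(** Columns increase downwards, so moving a box one row up keeps its entry at most [p]. This injects
    the counted boxes of row [r.+1] into those of row [r]. *)
Lemma ballot_tableau_word (s : 'S_N) : sorted geq lam -> is_SYT s ->
  ballot (size lam) (tableau_word s).
Proof.
move=> /(sortedP 0) slam syt; apply/ballotP => p r; rewrite size_tableau_word => pN rs.
rewrite !count_take_tableau_word //.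
have up_lt (j : 'I_N) : row j = r.+1 -> col j < nth 0 lam r.
  move=> rj; apply: leq_trans (slam r rs); rewrite -rj; exact: reshape_offsetP.
(* For [row j = r.+1] the flattened index is in range, so the default [j] of [insubd] is not taken
   there. *)
pose up (j : 'I_N) := insubd j (flatten_index lam r (col j)).
have upE (j : 'I_N) : row j = r.+1 -> up j = flatten_index lam r (col j) :> nat.
  by move=> rj; rewrite val_insubd flatten_indexP ?up_lt.
set A := [set j | _]; set B := [set j | _].
have up_inj : {in A &, injective up}.
  move=> j j'; rewrite !inE => /andP[_ /eqP rj] /andP[_ /eqP rj'].
  move=> /(congr1 val); rewrite /= !upE // => /(congr1 (reshape_offset lam)).
  rewrite !flatten_indexKr ?up_lt // => ec; apply: val_inj; apply: eq_row_col => //.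
  by rewrite rj rj'.
rewrite -(card_in_imset up_inj); apply: subset_leq_card; apply/subsetP => _ /imsetP[j + ->].
rewrite !inE => /andP[sj /eqP rj]; rewrite upE // flatten_indexKl ?up_lt // eqxx andbT.
apply: leq_trans sj.
have cj : col j < nth 0 lam r.+1 by rewrite -rj reshape_offsetP.
have := SYT_col_lt syt rs cj; rewrite -rj entryE.
have := entryE s (up j); rewrite upE // flatten_indexKl ?flatten_indexKr ?up_lt // => ->.
by move=> /ltnW.
Qed.

(* A tableau is recovered from its word: the column of an entry is the number of
   smaller entries in its row. *)
Lemma SYT_col_count (s : 'S_N) (j : 'I_N) : is_SYT s ->
  col j = count_mem (row j) (take (s j) (tableau_word s)).
Proof.
move=> syt; rewrite count_take_tableau_word; last exact: ltnW.
rewrite -[LHS](@card_row_prefix (row j)); last by apply: ltnW; apply: reshape_offsetP.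
apply: eq_card => j'; rewrite !inE andbC; case: eqP; rewrite ?andbF ?andbT // => rj.
have lt_entry (x y : 'I_N) : row x = row y -> col x < col y -> s x < s y.
  move=> rxy cxy; rewrite -ltnS -!entryE rxy.
  by apply: SYT_row_lt cxy _; rewrite ?reshape_indexP ?reshape_offsetP.
case: (ltngtP (col j') (col j)) => cj.
- by rewrite lt_entry.
- by have := lt_entry _ _ (esym rj) cj; lia.
- by rewrite (val_inj (eq_row_col rj cj)) ltnn.
Qed.

Lemma tableau_word_inj (s s' : 'S_N) : is_SYT s -> is_SYT s' ->
  tableau_word s = tableau_word s' -> s = s'.
Proof.
move=> syt syt' ew; apply: invg_inj; apply/permP => m; apply: val_inj.
have er : row ((s^-1)%g m) = row ((s'^-1)%g m) by rewrite -!nth_tableau_word ew.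
by apply: eq_row_col => //; rewrite (SYT_col_count _ syt) (SYT_col_count _ syt') !permKV er ew.
Qed.

(** The inverse construction puts the value of position [m] in row [x m], right after the earlier
    occurrences of that letter. Rows then increase by construction; columns increase by the ballot
    condition. *)
Lemma tableau_word_surj (w : seq nat) : size w = N -> all (gtn (size lam)) w ->
  content (size lam) w = lam -> ballot (size lam) w ->
  exists2 s : 'S_N, is_SYT s & tableau_word s = w.
Proof.
move=> sw wd cw /ballotP bal.
pose x m := nth 0 w m; pose c m := count_mem (x m) (take m w).
have xd m : m < N -> x m < size lam.
  by move=> mN; have /allP := wd; apply; rewrite mem_nth ?sw.
have cntw r : r < size lam -> count_mem r w = nth 0 lam r.
  by move=> rd; rewrite -[in RHS]cw nth_mkseq.
have cx m : m < N -> c m < nth 0 lam (x m).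
  move=> mN; rewrite -cntw ?xd // -[w]take_size sw.
  by apply: count_take_lt; rewrite ?sw.
pose t (m : 'I_N) := Ordinal (flatten_indexP (cx _ (ltn_ord m))).
have rt m : row (t m) = x m by rewrite /= flatten_indexKl ?cx.
have ct m : col (t m) = c m by rewrite /= flatten_indexKr ?cx.
have c_lt (m m' : nat) : m < m' < N -> x m = x m' -> c m < c m'.
  by move=> /andP[mm' m'N] ex; rewrite /c -ex; apply: count_take_lt => //; lia.
have t_inj : injective t.
  move=> m m' et; have ex : x m = x m' by rewrite -!rt et.
  have ec : c m = c m' by rewrite -!ct et.
  apply: val_inj; case: (ltngtP m m') => // lt_mm'.
    by have := @c_lt m m'; rewrite lt_mm' ltn_ord ec ltnn => /(_ isT ex).
  by have := @c_lt m' m; rewrite lt_mm' ltn_ord ec ltnn => /(_ isT (esym ex)).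
pose s := ((perm t_inj)^-1)%g.
have sE (m : 'I_N) : (s^-1)%g m = t m by rewrite /s invgK permE.
have entE r b : b < nth 0 lam r -> exists m : 'I_N, [/\ entry s r b = m.+1, x m = r & c m = b].
  move=> br; pose j := Ordinal (flatten_indexP br); exists (s j).
  have tj : t (s j) = j by rewrite -sE permK.
  split; first by rewrite -entryE /= flatten_indexKl ?flatten_indexKr.
    by rewrite -rt tj /= flatten_indexKl.
  by rewrite -ct tj /= flatten_indexKr.
exists s; last first.
  apply: (@eq_from_nth _ 0); rewrite size_tableau_word // => m mN.
  by rewrite (nth_tableau_word s (Ordinal mN)) sE rt.
apply/forallP => -[r rd]; apply/forallP => -[b bN] /=; apply/andP; split; apply/implyP.
  move=> br; have [m [-> xm cm]] := entE _ _ (ltnW br).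
  have [m' [-> xm' cm']] := entE _ _ br; rewrite ltnS.
  case: (ltngtP m m') => // [lt_mm'|/val_inj em].
    by have := @c_lt m' m; rewrite lt_mm' ltn_ord xm xm' cm cm' ltnNge leqnSn => /(_ isT erefl).
  by move: cm'; rewrite -em cm; lia.
move=> /andP[rd' br].
have [m' [-> xm' cm']] := entE _ _ br.
have [br0|br0] := ltnP b (nth 0 lam r); last first.
  have := bal (size w) r (leqnn _) rd'; rewrite take_size !cntw //; lia.
have [m [-> xm cm]] := entE _ _ br0; rewrite ltnS.
rewrite ltnNge leq_eqVlt; apply/negP => /orP[/eqP em | lt_mm'].
  by move: xm xm'; rewrite em => ->; lia.
(* If [m'] preceded [m], the prefix of length [m'.+1] would hold at most [b] letters [r] but more
   than [b] letters [r.+1]. *)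
have := bal m'.+1 r; rewrite sw => /(_ (ltn_ord _) rd'); apply/negP; rewrite -ltnNge.
apply: (@leq_ltn_trans b).
  rewrite -cm /c xm -(cat_take_drop m'.+1 (take m w)) take_takel // count_cat.
  exact: leq_addr.
rewrite -cm' /c xm' -!xm'; apply: count_take_lt => //; rewrite sw; exact: ltn_ord.
Qed.

End Tableaux.

(** * Words built by appending a last letter, and their descents *)

Fixpoint words (d N : nat) : seq (seq nat) :=
  if N is N'.+1 then [seq rcons w x | w <- words d N', x <- iota 0 d] else [:: [::]].

Lemma mem_words d N w : (w \in words d N) = (size w == N) && all (gtn d) w.
Proof.
elim: N w => [|N IH] w /=; first by case: w.
apply/allpairsP/andP => [[[v x] /= [+ + ->]] | []].
  rewrite IH mem_iota size_rcons all_rcons add0n => /andP[/eqP -> ->] /= ->.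
  by rewrite eqxx.
case/lastP: w => // w x; rewrite size_rcons all_rcons eqSS => sw /andP[xd wd].
by exists (w, x); rewrite /= IH mem_iota sw wd.
Qed.

Lemma uniq_words d N : uniq (words d N).
Proof.
elim: N => //= N IH; apply: allpairs_uniq => //; first exact: iota_uniq.
by move=> [w x] [w' x'] _ _ /= /rcons_inj [-> ->].
Qed.

Definition word_descents (w : seq nat) : seq nat :=
  [seq m <- iota 1 (size w).-1 | nth 0 w m.-1 < nth 0 w m].

(** The default in [last x w] ensures that the first letter of a word creates no descent. *)
Lemma word_descents_rcons w x : word_descents (rcons w x) =
  if last x w < x then rcons (word_descents w) (size w) else word_descents w.
Proof.
case/lastP: w => [|w y]; first by rewrite /= ltnn.
rewrite last_rcons /word_descents !size_rcons.
rewrite (_ : (size w).+2.-1 = size w + 1) ?iotaD ?addn1 // filter_cat /=.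
rewrite add1n !nth_rcons size_rcons ltnn eqxx ltnS leqnn.
rewrite add0n ltnn eqxx.
under eq_in_filter => m.
  rewrite mem_iota => m_in; have m_lt : m < (size w).+1 by lia.
  rewrite !(nth_rcons 0 (rcons w y)) size_rcons m_lt (_ : m.-1 < _); last by lia.
over.
by case: ltnP; rewrite ?cats0 ?cats1.
Qed.

Lemma descents_tableau_word (lam : seq nat) (s : 'S_(sumn lam)) :
  descents s = word_descents (tableau_word s).
Proof.
rewrite /descents /word_descents size_tableau_word; apply: eq_in_filter => m.
rewrite mem_iota => m_in; rewrite !(nth_map 0) ?size_iota; try lia.
by rewrite !nth_iota ?add1n ?prednK; try lia.
Qed.

Lemma content_rcons d w x : x < d -> content d (rcons w x) = incr_nth (content d w) x.
Proof.
move=> xd; apply: (@eq_from_nth _ 0).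
  by rewrite size_incr_nth !size_mkseq xd.
rewrite size_mkseq => r rd; rewrite nth_incr_nth !nth_mkseq //.
by rewrite -cats1 count_cat /= addn0 addnC.
Qed.

Lemma incr_nth_inj (s t : seq nat) x : size s = size t -> x < size s ->
  incr_nth s x = incr_nth t x -> s = t.
Proof.
move=> st xs e; apply: (@eq_from_nth _ 0) => // r _.
by have := congr1 (nth 0 ^~ r) e; rewrite !nth_incr_nth => /addnI.
Qed.

Lemma ballot_rcons d w x :
  ballot d (rcons w x) = ballot d w && sorted geq (content d (rcons w x)).
Proof.
rewrite /ballot size_rcons -addn1 iotaD all_cat [all _ (iota (0 + _) 1)]/= andbT.
rewrite [take (0 + _) _]take_oversize ?size_rcons ?addn1 //; congr andb; apply: eq_in_all => p.
by rewrite mem_iota => p_in; rewrite -cats1 takel_cat //; lia.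
Qed.

Lemma ballot_sorted d w : ballot d w -> sorted geq (content d w).
Proof. by move/allP/(_ (size w)); rewrite take_size mem_iota add0n ltnS leqnn; apply. Qed.

(** * Generating functions of ballot words *)

Local Open Scope ring_scope.

Section GeneratingFunctions.

Variables (R : comNzRingType) (q : R).

Definition word_weight (w : seq nat) : {poly R} :=
  q ^+ sumn (word_descents w) *: 'X^(size (word_descents w)).

(* The variable of the polynomial marks descents.  The last letter is required to be
   below [x]; for the empty word it counts as [d - 1], so that the first letter of a
   word never creates a descent. *)
Definition word_gf (d N : nat) (mu : seq nat) (x : nat) : {poly R} :=
  \sum_(w <- words d N | [&& ballot d w, content d w == mu & (last d.-1 w < x)%N])
    word_weight w.

Lemma word_weight_rcons d w x : (x < d)%N -> word_weight (rcons w x) =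
  (if (last d.-1 w < x)%N then q ^+ size w *: 'X else 1) * word_weight w.
Proof.
move=> xd; rewrite /word_weight word_descents_rcons.
(* The two defaults matter only for the empty word, where [x < x] and [d.-1 < x] are both false. *)
have -> : (last x w < x)%N = (last d.-1 w < x)%N by case: w => //=; lia.
case: ifP => _; last by rewrite mul1r.
by rewrite sumn_rcons size_rcons exprD exprS -scalerAl -scalerAr scalerA mulrC.
Qed.

Lemma word_gf0 d N mu : word_gf d N mu 0 = 0.
Proof. by rewrite /word_gf big1 // => w; rewrite ltn0 !andbF. Qed.

Lemma word_gf_unsorted d N mu x : ~~ sorted geq mu -> word_gf d N mu x = 0.
Proof.
move=> nmu; rewrite /word_gf big1 // => w /and3P[/ballot_sorted + /eqP cw].
by rewrite cw (negPf nmu).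
Qed.

Lemma word_gfS d N mu x : word_gf d N mu x.+1 = word_gf d N mu x +
  \sum_(w <- words d N | [&& ballot d w, content d w == mu & last d.-1 w == x])
    word_weight w.
Proof.
rewrite /word_gf !(big_mkcond (fun w => [&& _, _ & _])) -big_split /=; apply: eq_bigr => w _.
case: ballot => /=; last by rewrite addr0.
case: eqP => _ /=; last by rewrite addr0.
by rewrite ltnS leq_eqVlt; case: ltngtP; rewrite ?addr0 ?add0r.
Qed.

(** A nonempty word ending in [x] contains [x]. The length [N.+1] excludes the empty word, whose
    conventional last letter is [d.-1]. *)
Lemma word_gf_absent d N mu x : (x < d)%N -> nth 0%N mu x = 0%N ->
  word_gf d N.+1 mu x.+1 = word_gf d N.+1 mu x.
Proof.
move=> xd mux; rewrite word_gfS [X in _ + X]big_seq_cond big1 ?addr0 // => w.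
rewrite mem_words => /andP[/andP[/eqP sw _] /and3P[_ /eqP cw /eqP lw]].
move: mux; rewrite -cw nth_mkseq //; case/lastP: w sw lw {cw} => // w y _.
by rewrite last_rcons => ->; rewrite -cats1 count_cat /= eqxx addn0 addn1.
Qed.

(** Appending [x] to a word of content [mu] multiplies its weight by [q ^+ N *: 'X] if its last
    letter is below [x], and by 1 otherwise. The bound [d] admits every last letter. *)
Lemma word_gf_rcons d N mu nu x : (x < d)%N -> size mu = d ->
  nu = incr_nth mu x -> sorted geq nu ->
  word_gf d N.+1 nu x.+1 = word_gf d N.+1 nu x +
    (word_gf d N mu d - (1 - q ^+ N *: 'X) * word_gf d N mu x).
Proof.
move=> xd smu -> sortmu; rewrite word_gfS; congr (_ + _).
rewrite /word_gf big_mkcond big_allpairs_dep.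
rewrite !(big_mkcond (fun w => [&& _, _ & _])) mulr_sumr -sumrB /=.
apply: eq_big_seq => w; rewrite mem_words => /andP[/eqP sw wd].
rewrite (bigD1_seq x) ?mem_iota ?iota_uniq //= big1 ?addr0 => [|y yx]; last first.
  by rewrite last_rcons (negPf yx) !andbF.
have -> : (last d.-1 w < d)%N.
  case/lastP: w wd {sw} => [|w y]; first by rewrite /=; lia.
  by rewrite all_rcons last_rcons => /andP[].
rewrite last_rcons eqxx !andbT ballot_rcons content_rcons //.
have -> : (incr_nth (content d w) x == incr_nth mu x) = (content d w == mu).
  apply/eqP/eqP => [|-> //]; apply: incr_nth_inj; rewrite size_mkseq ?smu //.
rewrite (word_weight_rcons w xd) sw; case: eqP => [-> | _] /=; last by rewrite !andbF mulr0 subr0.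
rewrite sortmu !andbT; case: ballot => /=; last by rewrite mulr0 subr0.
by case: ltnP => _; rewrite ?mulr0 ?subr0 ?mul1r // mulrBl mul1r opprB addrC subrK.
Qed.

(** * Recurrences for shapes with at most three rows *)

Definition gf3 (a b c : nat) : {poly R} := word_gf 3 (a + b + c) [:: a; b; c] 3.

Lemma gf3_unsorted a b c : ~~ (c <= b <= a)%N -> gf3 a b c = 0.
Proof. by move=> nabc; rewrite /gf3 word_gf_unsorted //= andbT andbC. Qed.

Lemma gf3_row1 n : gf3 n 0 0 = 1.
Proof.
elim: n => [|n IH].
  by rewrite /gf3 /word_gf /= big_mkcond big_seq1 /= /word_weight /= expr0 scale1r.
rewrite /gf3 !addSn (@word_gf_absent 3 _ [:: n.+1; 0; 0]%N 2) // word_gf_absent //.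
rewrite (@word_gf_rcons 3 _ [:: n; 0; 0]%N [:: n.+1; 0; 0]%N 0) // !word_gf0 mulr0 subr0 add0r.
exact: IH.
Qed.

Lemma word_gf3_row2 n k c : (c <= k.+1)%N -> (k <= n)%N ->
  word_gf 3 (n.+1 + k.+1 + c) [:: n.+1; k.+1; c] 2 =
  gf3 n k.+1 c + gf3 n.+1 k c - (1 - q ^+ (n + k + c).+1 *: 'X) * gf3 n k c.
Proof.
move=> ck kn.
(* Words ending in 0 lose that letter without losing a descent. *)
have row1 k' : (c <= k' <= n.+1)%N ->
    word_gf 3 (n.+1 + k' + c) [:: n.+1; k'; c] 1 = gf3 n k' c.
  move=> /andP[ck' k'n]; rewrite !addSn (@word_gf_rcons 3 _ [:: n; k'; c] [:: n.+1; k'; c] 0) //=.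
    by rewrite !word_gf0 mulr0 subr0 add0r.
  by rewrite ck' k'n.
rewrite [in LHS]addnS addSn (@word_gf_rcons 3 _ [:: n.+1; k; c] [:: n.+1; k.+1; c] 1) //=; last first.
  by rewrite ltnS kn ck.
rewrite -addSn -addnS row1 ?ck ?ltnS //.
have [ck'|] := leqP c k; first by rewrite row1 ?ck' ?leqW // -addrA !addSn.
(* Here [c = k.+1], so every term with second row [k] violates the partition condition and
   vanishes. *)
move=> kc; rewrite ![gf3 _ k c]gf3_unsorted ?(word_gf_unsorted 3 _ 1) //=; try by lia.
by rewrite !mulr0 !subr0 word_gf_unsorted //=; lia.
Qed.

Lemma gf3_rec0 n k : (k <= n)%N -> gf3 n.+1 k.+1 0 =
  gf3 n k.+1 0 + gf3 n.+1 k 0 - (1 - q ^+ (n + k).+1 *: 'X) * gf3 n k 0.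
Proof.
move=> kn; rewrite {1}/gf3 !addSn (@word_gf_absent 3 _ [:: n.+1; k.+1; 0]%N) //.
by rewrite -!addSn word_gf3_row2 // addn0.
Qed.

Lemma word_gf3_row3 n k c : (c < k)%N -> (k <= n)%N ->
  gf3 n k c.+1 = word_gf 3 (n + k + c.+1) [:: n; k; c.+1] 2 +
    (gf3 n k c - (1 - q ^+ (n + k + c) *: 'X) * word_gf 3 (n + k + c) [:: n; k; c] 2).
Proof.
move=> ck kn; rewrite {1}/gf3 addnS (@word_gf_rcons 3 _ [:: n; k; c] [:: n; k; c.+1] 2) //=.
by rewrite kn ck.
Qed.

Lemma word_gf3_top2_0 n k :
  word_gf 3 (n.+1 + k.+1 + 0) [:: n.+1; k.+1; 0]%N 2 = gf3 n.+1 k.+1 0.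
Proof. by rewrite /gf3 !addSn (@word_gf_absent 3 _ [:: n.+1; k.+1; 0]%N 2). Qed.

Lemma gf3_rec1 n k : (k <= n)%N -> gf3 n.+1 k.+1 1 =
  gf3 n k.+1 1 + gf3 n.+1 k 1 - (1 - q ^+ (n + k).+2 *: 'X) * gf3 n k 1
  + (q ^+ (n + k).+2 *: 'X) * gf3 n.+1 k.+1 0.
Proof.
move=> kn; rewrite word_gf3_row3 // word_gf3_top2_0 word_gf3_row2 //.
rewrite addn1 addn0 addSn addnS; ring.
Qed.

Lemma gf3_rec2 n k : (0 < k)%N -> (k <= n)%N -> gf3 n.+1 k.+1 2 =
  gf3 n k.+1 2 + gf3 n.+1 k 2 - (1 - q ^+ (n + k).+3 *: 'X) * gf3 n k 2
  + (q ^+ (n + k).+3 *: 'X) * gf3 n.+1 k.+1 1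
  + (1 - q ^+ (n + k).+3 *: 'X) * (q ^+ (n + k).+2 *: 'X) * gf3 n.+1 k.+1 0.
Proof.
move=> k0 kn; rewrite word_gf3_row3 // word_gf3_row2 //.
(* The words of content [(n+1, k+1, 1)] not ending in 2 remain to be eliminated: they are all words
   of this content minus those obtained by appending 2 to a two-row word. *)
have := @word_gf3_row3 n.+1 k.+1 0 isT kn; rewrite word_gf3_top2_0.
move/eqP; rewrite -subr_eq => /eqP <-.
rewrite addn0 addn1 addn2 addSn addnS; ring.
Qed.

End GeneratingFunctions.

(** * Product formulas for three rows *)

Definition mixed_diff (V : zmodType) (u : nat -> nat -> V) (n k : nat) : V :=
  u n.+1 k.+1 - u n k.+1 - u n.+1 k + u n k.

(** The mixed difference gives the value at [(n+1, k+1)] from those at [(n, k+1)], [(n+1, k)] and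
    [(n, k)], all within the region [k <= n+1]. *)
Lemma eq_mixed_diff (V : zmodType) (u v : nat -> nat -> V) :
  (forall n, u n 0%N = v n 0%N) -> (forall n, u n n.+1 = v n n.+1) ->
  (forall n k, (k <= n)%N -> mixed_diff u n k = mixed_diff v n k) ->
  forall n k, (k <= n.+1)%N -> u n k = v n k.
Proof.
move=> uv0 uvd uvD; elim=> [|n IHn] k; first by case: k => [|[|k]].
elim: k => [|k IHk] kn; first exact: uv0.
move: kn; rewrite ltnS leq_eqVlt => /orP[/eqP -> | kn]; first exact: uvd.
have := uvD n k kn; rewrite /mixed_diff IHn // IHk ?leqW // IHn ?leqW //.
by move/addIr/addIr/addIr.
Qed.

Section ClosedForms.

(* [B n j] stands for the Gaussian binomial; only its two ratio laws matter, and
   they hold for all [n] and [j], including [j > n] where it vanishes. *)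
Variables (F : fieldType) (q : F) (B : nat -> nat -> F).
Hypothesis q_neq0 : q != 0.
Hypothesis subq_neq0 : forall m, 1 - q ^+ m.+1 != 0.
Hypothesis B0 : forall n, B n 0 = 1.
Hypothesis BSS : forall n j, B n.+1 j.+1 = (1 - q ^+ n.+1) / (1 - q ^+ j.+1) * B n j.
Hypothesis BnS : forall n j,
  B n j.+1 = (q ^+ j - q ^+ n) / (q ^+ j * (1 - q ^+ j.+1)) * B n j.

Local Notation t c := (fun i n k => (gf3 q n k c)`_i).

Lemma gf3_gap c i n : (gf3 q n n.+1 c)`_i = 0.
Proof. by rewrite gf3_unsorted ?coef0 // ltnn andbF. Qed.

Lemma gf3_short c i n k : (k < c)%N -> (gf3 q n k c)`_i = 0.
Proof. by move=> kc; rewrite gf3_unsorted ?coef0 // leqNgt kc. Qed.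

Lemma mixed_diff0 i n k : (k <= n)%N -> mixed_diff (t 0 i) n k =
  if i is i'.+1 then q ^+ (n + k).+1 * (gf3 q n k 0)`_i' else 0.
Proof.
move=> kn; rewrite /mixed_diff gf3_rec0 // mulrBl mul1r -scalerAl.
by rewrite !coefD !coefN !coefD coefN coefZ coefXM; case: i => [|i] /=; ring.
Qed.

Lemma mixed_diff1 i n k : (k <= n)%N -> mixed_diff (t 1 i) n k =
  if i is i'.+1 then q ^+ (n + k).+2 * ((gf3 q n k 1)`_i' + (gf3 q n.+1 k.+1 0)`_i')
  else 0.
Proof.
move=> kn; rewrite /mixed_diff gf3_rec1 // mulrBl mul1r -!scalerAl.
by rewrite !(coefD, coefN, coefZ, coefXM); case: i => [|i] /=; ring.
Qed.

Lemma mixed_diff2 i n k : (0 < k)%N -> (k <= n)%N -> mixed_diff (t 2 i.+1) n k =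
  q ^+ (n + k).+3 * ((gf3 q n k 2)`_i + (gf3 q n.+1 k.+1 1)`_i)
  + q ^+ (n + k).+2 * (gf3 q n.+1 k.+1 0)`_i
  - q ^+ (n + k).+3 * q ^+ (n + k).+2 *
    (if i is i'.+1 then (gf3 q n.+1 k.+1 0)`_i' else 0).
Proof.
move=> k0 kn; rewrite /mixed_diff gf3_rec2 // -mulrA !mulrBl !mul1r -!scalerAl.
rewrite !(coefD, coefN, coefZ, coefXM); case: i => [|i] /=; ring.
Qed.

Lemma gf3_coef0 n k : (k <= n)%N -> (gf3 q n k.+1 0)`_0 = 0.
Proof.
(* Among shapes with at most two rows, only one-row shapes have a tableau without descents. *)
move=> kn; pose v (n k : nat) : F := (k == 0%N)%:R.
rewrite (@eq_mixed_diff _ (t 0 0%N) v) //.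
- by move=> m; rewrite gf3_row1 coef1.
- exact: gf3_gap.
by move=> m l lm; rewrite mixed_diff0 // /mixed_diff /v /=; ring.
Qed.

(** Three nonempty rows force at least two descents. *)
Lemma gf3_coef1 n k i : (i < 2)%N -> (k <= n.+1)%N -> (gf3 q n k 1)`_i = 0.
Proof.
move=> i2; apply: (@eq_mixed_diff _ (t 1 i) (fun _ _ => 0)).
- by move=> m; rewrite gf3_short.
- exact: gf3_gap.
elim: i i2 => [|[|i] IH] // _ m l lm; rewrite mixed_diff1 // /mixed_diff; first by ring.
rewrite gf3_coef0 ?leqW // (@eq_mixed_diff _ (t 1 0%N) (fun _ _ => 0)) ?leqW //; first by ring.
- by move=> m'; rewrite gf3_short.
- exact: gf3_gap.
exact: IH.
Qed.

(** The recurrence for a third row of length 2 needs [0 < k], hence the shift by one. The boundary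
    [k = 0] is then the non-partition [(n+1, 1, 2)]. *)
Lemma eq_mixed_diff2 (v : nat -> nat -> F) i :
  (forall n, v n 0%N = 0) -> (forall n, v n n.+1 = 0) ->
  (forall n k, (k <= n)%N -> mixed_diff (t 2 i) n.+1 k.+1 = mixed_diff v n k) ->
  forall n k, (k <= n.+1)%N -> (gf3 q n.+1 k.+1 2)`_i = v n k.
Proof.
move=> v0 vd vD; apply: (@eq_mixed_diff _ (fun n k => t 2 i n.+1 k.+1)) => //.
- by move=> n; rewrite v0 gf3_short.
- by move=> n; rewrite vd gf3_gap.
Qed.

Lemma gf3_coef2 n k : (k <= n.+1)%N -> (gf3 q n.+1 k.+1 2)`_1 = 0.
Proof.
(* [mixed_diff2] starts in degree 1, so the constant coefficient comes directly from the
   recurrence. *)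
have c0 n' k' : (k' <= n'.+1)%N -> (gf3 q n'.+1 k'.+1 2)`_0 = 0.
  apply: (@eq_mixed_diff2 (fun _ _ => 0)) => // m l lm.
  rewrite /mixed_diff gf3_rec2 // -mulrA !mulrBl !mul1r -!scalerAl.
  by rewrite !(coefD, coefN, coefZ, coefXM) /=; ring.
apply: (@eq_mixed_diff2 (fun _ _ => 0)) => // m l lm.
rewrite mixed_diff2 // c0 ?gf3_coef1 ?gf3_coef0 /mixed_diff; try lia; by ring.
Qed.

(* Coefficient of [z^(j+1)] for the shape [(n, k+1)], resp. of [z^(j+2)] for the
   shapes [(n, k, 1)] and [(n+1, k+1, 2)]. *)
Definition closed0 (j n k : nat) : F :=
  q ^+ (j ^ 2 + j) * (q ^+ k.+1 - q ^+ n.+1) / (1 - q ^+ j.+1) * B n j * B k j.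

Definition closed1 (j n k : nat) : F :=
  q ^+ (j ^ 2 + 2 * j + 2) * (q ^+ k - q ^+ n.+1) / (1 - q)
  * ((1 - q ^+ j.+1) / (1 - q ^+ j.+2)) * B n.+1 j.+1 * B k j.+1.

Definition closed2 (j n k : nat) : F :=
  q ^+ (j ^ 2 + j + 4) * ((q ^+ k.+1 - q ^+ n.+2) * (1 - q ^+ k) * (1 - q ^+ n.+1))
  / ((1 - q ^+ j.+1) * (1 - q) * (1 - q ^+ 2)) * B n.+2 j * B k.+1 j.

Lemma B0S j : B 0 j.+1 = 0.
Proof. by elim: j => [|j IH]; rewrite BnS ?IH ?mulr0 // subrr !mul0r. Qed.

Lemma gf3_closed0 j n k : (k <= n)%N -> (gf3 q n k.+1 0)`_j.+1 = closed0 j n k.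
Proof.
(* [closed0] is indexed by the second row minus one; [v] extends it by 0 to one-row shapes, which
   have no descents. *)
move=> kn; pose v j n k := if k is k'.+1 then closed0 j n k' else 0.
suff: forall n k, (k <= n.+1)%N -> (gf3 q n k 0)`_j.+1 = v j n k.
  by move=> /(_ n k.+1); apply.
have q1 := subq_neq0 0; rewrite expr1 in q1.
elim: j {n k kn} => [|j IH]; apply: eq_mixed_diff.
- by move=> n; rewrite gf3_row1 coef1.
- by move=> n; rewrite gf3_gap /v /closed0 subrr mulr0 !mul0r.
- move=> n [|k] kn; rewrite mixed_diff0 //.
    rewrite gf3_row1 coef1 addn0 /mixed_diff /v /closed0 !B0 /= !exprS expr0.
    by field.
  rewrite gf3_coef0 ?(ltnW kn) // /mixed_diff /v /closed0 !B0 !exprS; by field.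
- by move=> n; rewrite gf3_row1 coef1.
- by move=> n; rewrite gf3_gap /v /closed0 subrr mulr0 !mul0r.
move=> n k kn; rewrite mixed_diff0 // IH ?leqW // {IH}.
have qj1 := subq_neq0 j; have qj2 := subq_neq0 j.+1.
have qj : q ^+ j != 0 by rewrite expf_neq0.
(* The quadratic exponents are reduced to one common power, which [field] can treat as an atom. *)
have eQ : q ^+ (j.+1 ^ 2 + j.+1) = q ^+ (j ^ 2 + j) * (q ^+ j) ^+ 2 * q ^+ 2.
  by rewrite -exprM -!exprD; congr (_ ^+ _); lia.
case: k kn => [|k] kn; rewrite /v /mixed_diff /closed0 eQ; first by rewrite !B0S; ring.
(* The ratio laws reduce all binomials to [B n j] and [B k j], leaving a rational identity in powers
   of [q]. *)
rewrite !BSS !BnS; move: qj1 qj2; rewrite addnS !exprS exprD => qj1 qj2; field.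
by rewrite qj1 qj qj2.
Qed.

Lemma gf3_closed1 j n k : (k <= n.+1)%N -> (gf3 q n k 1)`_j.+2 = closed1 j n k.
Proof.
have q1 := subq_neq0 0; rewrite expr1 in q1.
have gap j' m : closed1 j' m m.+1 = 0 by rewrite /closed1 subrr mulr0 !mul0r.
move: n k; elim: j => [|j IH]; apply: eq_mixed_diff.
- by move=> n; rewrite gf3_short // /closed1 B0S mulr0.
- by move=> n; rewrite gf3_gap gap.
- move=> n k kn; rewrite mixed_diff1 // gf3_coef1 ?gf3_closed0; try lia.
  have q2 := subq_neq0 1; have q3 := subq_neq0 2.
  rewrite /mixed_diff /closed1 /closed0 !BSS !BnS !B0.
  move: q2 q3; rewrite !exprS exprD !expr0 => q2 q3; field.
  by rewrite ?mulr1 in q1 q2 q3 *; rewrite ?q1 ?q2 ?q3.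
- by move=> n; rewrite gf3_short // /closed1 B0S mulr0.
- by move=> n; rewrite gf3_gap gap.
move=> n k kn; rewrite mixed_diff1 // IH ?leqW // gf3_closed0 ?leqW // {IH}.
have qj1 := subq_neq0 j; have qj2 := subq_neq0 j.+1; have qj3 := subq_neq0 j.+2.
have qj : q ^+ j != 0 by rewrite expf_neq0.
have eQ1 : q ^+ (j.+1 ^ 2 + 2 * j.+1 + 2) = q ^+ (j ^ 2 + j) * (q ^+ j) ^+ 3 * q ^+ 5.
  by rewrite -exprM -!exprD; congr (_ ^+ _); lia.
have eQ2 : q ^+ (j ^ 2 + 2 * j + 2) = q ^+ (j ^ 2 + j) * q ^+ j * q ^+ 2.
  by rewrite -!exprD; congr (_ ^+ _); lia.
have eQ3 : q ^+ (j.+1 ^ 2 + j.+1) = q ^+ (j ^ 2 + j) * (q ^+ j) ^+ 2 * q ^+ 2.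
  by rewrite -exprM -!exprD; congr (_ ^+ _); lia.
rewrite /mixed_diff /closed1 /closed0 eQ1 eQ2 eQ3.
rewrite [B n.+2 _]BSS [B n.+1 j.+2]BnS [B k.+1 _]BSS [B k j.+2]BnS.
move: qj1 qj2 qj3; rewrite !exprS exprD => qj1 qj2 qj3; field.
by rewrite ?q_neq0 ?q1 ?qj1 ?qj2 ?qj3 ?qj.
Qed.

Lemma gf3_closed2 j n k : (k <= n.+1)%N -> (gf3 q n.+1 k.+1 2)`_j.+2 = closed2 j n k.
Proof.
have q1 := subq_neq0 0; rewrite expr1 in q1.
have q2 := subq_neq0 1.
have gap j' m : closed2 j' m m.+1 = 0 by rewrite /closed2 subrr !mul0r mulr0 !mul0r.
have short j' m : closed2 j' m 0 = 0.
  by rewrite /closed2 expr0 subrr mulr0 !(mul0r, mulr0).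
move: n k; elim: j => [|j IH]; apply: eq_mixed_diff2 => // n k kn; rewrite mixed_diff2 //.
  (* In degree 2 only the linear coefficient of the two-row shape survives. *)
  rewrite gf3_coef2 ?gf3_coef1 ?gf3_coef0 ?gf3_closed0; try lia.
  rewrite /mixed_diff /closed2 /closed0 !B0.
  move: q2; rewrite !addSn !addnS !exprS exprD !expr0 !mulr1 => q2; field.
  by rewrite ?q1 ?q2.
rewrite IH ?gf3_closed1 ?gf3_closed0; try lia.
have qj1 := subq_neq0 j; have qj2 := subq_neq0 j.+1.
have qj : q ^+ j != 0 by rewrite expf_neq0.
have eQ1 : q ^+ (j.+1 ^ 2 + j.+1 + 4) = q ^+ (j ^ 2 + j) * (q ^+ j) ^+ 2 * q ^+ 6.
  by rewrite -exprM -!exprD; congr (_ ^+ _); lia.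
have eQ2 : q ^+ (j ^ 2 + 2 * j + 2) = q ^+ (j ^ 2 + j) * q ^+ j * q ^+ 2.
  by rewrite -!exprD; congr (_ ^+ _); lia.
have eQ3 : q ^+ (j.+1 ^ 2 + j.+1) = q ^+ (j ^ 2 + j) * (q ^+ j) ^+ 2 * q ^+ 2.
  by rewrite -exprM -!exprD; congr (_ ^+ _); lia.
have eQ4 : q ^+ (j ^ 2 + j + 4) = q ^+ (j ^ 2 + j) * q ^+ 4 by rewrite exprD.
rewrite /mixed_diff /closed2 /closed1 /closed0 eQ1 eQ2 eQ3 eQ4.
(* The common binomials are now [B n.+2 j] and [B k.+1 j]. *)
rewrite [B n.+3 _]BSS [B n.+2 j.+1]BnS [B k.+2 _]BSS [B k.+1 j.+1]BnS.
move: q2 qj1 qj2; rewrite !addSn !addnS !exprS exprD !expr0 !mulr1 => q2 qj1 qj2; field.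
by rewrite ?q_neq0 ?q1 ?q2 ?qj1 ?qj2 ?qj.
Qed.

End ClosedForms.

(** * The field of rational functions *)

Lemma divM_split (F : fieldType) (a b c d e : F) :
  a * b / (c * d * e) = b / d * (a / (c * e)).
Proof. by rewrite !invfM; ring. Qed.

(** Used with [u = q ^+ j] and [z = q ^+ (n - j)], so that [u - u * z] is the numerator
    [q ^+ j - q ^+ n]. *)
Lemma div_shift (F : fieldType) (a b c d u z : F) :
  b != 0 -> c != 0 -> d != 0 -> u != 0 -> 1 - z != 0 ->
  a / (b * c * d) = (u - u * z) / (u * c) * (a / (b * (d * (1 - z)))).
Proof. by move=> b0 c0 d0 u0 z1; field; rewrite b0 c0 d0 u0 z1. Qed.

Lemma factor_power (F : fieldType) (a y z b c d e f : F) :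
  a * ((y - y * z) * b * c) / d * e * f = a * y * ((1 - z) * b * c / d) * e * f.
Proof. by ring. Qed.

Lemma q_neq0 : q != 0.
Proof. by rewrite /q /toRF tofrac_eq0 polyX_eq0. Qed.

Lemma subq_neq0 m : 1 - q ^+ m.+1 != 0.
Proof.
rewrite /q /toRF -tofracXn -tofrac1 -tofracB tofrac_eq0 subr_eq0 eq_sym.
by apply/eqP => /(congr1 (size \o polyseq)) /=; rewrite size_polyXn size_poly1.
Qed.

Lemma qpochS m : qpoch m.+1 = qpoch m * (1 - q ^+ m.+1).
Proof. by rewrite /qpoch big_nat_recr. Qed.

Lemma qpoch_neq0 m : qpoch m != 0.
Proof.
elim: m => [|m IH]; first by rewrite /qpoch big_geq // oner_neq0.
by rewrite qpochS mulf_neq0 ?subq_neq0.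
Qed.

Lemma qbinom0 n : qbinom n 0 = 1.
Proof. by rewrite /qbinom subn0 [qpoch 0]big_geq // mul1r divff ?qpoch_neq0. Qed.

Lemma qbinomSS n j :
  qbinom n.+1 j.+1 = (1 - q ^+ n.+1) / (1 - q ^+ j.+1) * qbinom n j.
Proof.
rewrite /qbinom ltnS subSS; case: leqP => _; last by rewrite mulr0.
by rewrite !qpochS divM_split.
Qed.

Lemma qbinomS n j : qbinom n j.+1 =
  (q ^+ j - q ^+ n) / (q ^+ j * (1 - q ^+ j.+1)) * qbinom n j.
Proof.
(* At [j = n] the left side is 0 by convention and the numerator on the right vanishes. *)
rewrite /qbinom; case: ltngtP => [jn | _ | <-]; last 2 first.
- by rewrite mulr0.
- by rewrite subrr !mul0r.
have -> : (n - j = (n - j.+1).+1)%N by lia.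
rewrite [qpoch j.+1]qpochS [qpoch (n - j.+1).+1]qpochS.
have -> : q ^+ n = q ^+ j * q ^+ (n - j.+1).+1 by rewrite -exprD; congr (_ ^+ _); lia.
by apply: div_shift; rewrite ?qpoch_neq0 ?subq_neq0 ?expf_neq0 ?q_neq0.
Qed.

(** [tableau_word] is a bijection from standard tableaux to ballot words of content [lam].
    Nonemptiness of [lam] puts the conventional last letter of the empty word below [size lam]. *)
Lemma intRF_f_poly (lam : seq nat) (i : nat) : lam != [::] -> sorted geq lam ->
  intRF (f_poly lam i) = (word_gf q (size lam) (sumn lam) lam (size lam))`_i.
Proof.
move=> lam0 slam; pose wt (w : seq nat) : RF :=
  q ^+ sumn (word_descents w) * (i == size (word_descents w))%:R.
have -> : intRF (f_poly lam i) = \sum_(s : 'S_(sumn lam) | is_SYT s) wt (tableau_word s).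
  rewrite /intRF /toRF /f_poly rmorph_sum rmorph_sum big_mkcondr; apply: eq_bigr => s _.
  rewrite /wt -descents_tableau_word eq_sym -/(des s); case: eqP => _; last by rewrite mulr0.
  by rewrite mulr1 /= map_polyXn tofracXn.
pose syts := [pred s : 'S_(sumn lam) | is_SYT s].
rewrite /word_gf coef_sum -[RHS]big_filter -[LHS](big_image _ _ _ syts).
under [RHS]eq_bigr do rewrite coefZ coefXn -/(wt _).
apply: perm_big; apply: uniq_perm.
- rewrite map_inj_in_uniq ?enum_uniq // => s s'; rewrite !mem_enum.
  exact: tableau_word_inj.
- by rewrite filter_uniq ?uniq_words.
move=> w; rewrite mem_filter mem_words; apply/mapP/idP => [[s + ->] | ].
  rewrite mem_enum => syt; rewrite ballot_tableau_word // content_tableau_word eqxx.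
  rewrite size_tableau_word eqxx /=.
  have letters : all (gtn (size lam)) (tableau_word s).
    apply/(all_nthP 0%N) => m; rewrite size_tableau_word => mN /=.
    by rewrite (nth_tableau_word s (Ordinal mN)) reshape_indexP.
  rewrite letters andbT; case/lastP: (tableau_word s) letters => [_|v x].
    by case: (lam) lam0.
  by rewrite last_rcons all_rcons => /andP[].
move=> /andP[/and3P[bal /eqP cont _] /andP[/eqP sw letters]].
have [s syt <-] := tableau_word_surj sw letters cont bal.
by exists s; rewrite ?mem_enum.
Qed.

Theorem mainTheorem5 (n k i : nat) (hkn : (k <= n)%N) (hk : (2 <= k)%N)
    (hi : (2 <= i)%N) :
  intRF (f_poly [:: n; k; 2%N] i) =
  q ^+ (k + (i * i + 6 - 3 * i))%N *
    ((1 - q ^+ (n - k + 1)) * (1 - q ^+ (k - 1)) * (1 - q ^+ n)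
     / ((1 - q ^+ (i - 1)) * (1 - q) * (1 - q ^+ 2)))
    * qbinom n.+1 (i - 2) * qbinom k (i - 2).
Proof.
rewrite intRF_f_poly //=; last by rewrite hkn hk.
rewrite addn0 addnA -/(gf3 q n k 2).
case: n hkn => [|n] hkn; first by lia.
case: k hkn hk => [|k] // hkn hk.
case: i hi => [|[|j]] // _.
rewrite (gf3_closed2 q_neq0 subq_neq0 qbinom0 qbinomSS qbinomS) ?leqW // /closed2.
rewrite !subSS !subn0.
have -> : (k.+1 + (j.+2 * j.+2 + 6 - 3 * j.+2) = (j ^ 2 + j + 4) + k.+1)%N by lia.
(* This factors [q ^+ k.+1] out of the difference [q ^+ k.+1 - q ^+ n.+2] in [closed2]. *)
have -> : q ^+ n.+2 = q ^+ k.+1 * q ^+ (n - k + 1).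
  by rewrite -exprD; congr (_ ^+ _); lia.
by rewrite [in RHS]exprD factor_power.
Qed.
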